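(* Let $R$ be a firm ring, let $\widehat{R}$ be its Dorroh extension, and let $\mathfrak{R}=(R,\Delta,\iota)$ be the associated $\widehat{R}$-coring, whose underlying $\widehat R$-bimodule is $R$, whose comultiplication is the inverse multiplication map $\Delta=\mathsf{d}_R:R\to R\otimes_R R\cong R\otimes_{\widehat{R}}R$, and whose counit is the inclusion $\iota:R\to\widehat{R}$, $\iota(r)=(r,0)$. Then the category $\mathcal{M}_R$ of firm right $R$-modules and the category $\mathcal{M}^{\mathfrak{R}}$ of right $\mathfrak{R}$-comodules are isomorphic.
   Context: Rings are associative and not necessarily unital unless stated. For a ring $R$, a right $R$-module $M$ is firm if the multiplication map $M\otimes_R R\to M$, $m\otimes r\mapsto mr$, is an isomorphism (here $M\otimes_R R$ is the quotient of $M\otimes_{\mathbb Z}R$ by the relations $mr\otimes s=m\otimes rs$); firm left modules are defined symmetrically. $\mathcal M_R$ is the category of firm right $R$-modules with all right $R$-linear maps. $R$ is a firm ring if it is firm as a right (equivalently, left) $R$-module; then $\mathsf d_R:R\to R\otimes_RR$ denotes the inverse of the multiplication map $\mu_R$. The Dorroh extension of $R$ is the unital ring $\widehat R=R\times\mathbb Z$ with componentwise addition, multiplication $(r,x)(r',x')=(rr'+rx'+xr',xx')$ and unit $(0,1)$. Every right $R$-module is a unital right $\widehat R$-module by $m(r,x)=mr+mx$, and similarly on the left. The canonical surjection $M\otimes_RR\to M\otimes_{\widehat R}R$ is an isomorphism. For a unital ring $A$, an $A$-coring is an $A$-bimodule $\mathfrak C$ with $A$-bilinear maps $\Delta_{\mathfrak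 C}:\mathfrak C\to\mathfrak C\otimes_A\mathfrak C$ and $\varepsilon_{\mathfrak C}:\mathfrak C\to A$ that are coassociative and counital. A right $\mathfrak C$-comodule is a right $A$-module $M$ with a right $A$-linear map $\rho_M:M\to M\otimes_A\mathfrak C$ satisfying $(\rho_M\otimes_A\mathfrak C)\circ\rho_M=(M\otimes_A\Delta_{\mathfrak C})\circ\rho_M$ and $(M\otimes_A\varepsilon_{\mathfrak C})\circ\rho_M=M$ (identity). Morphisms in $\mathcal M^{\mathfrak C}$ are right $A$-linear maps $f$ with $\rho_N\circ f=(f\otimes_A\mathfrak C)\circ\rho_M$. *)

(* Defs.v *)
From HB Require Import structures.
From mathcomp Require Import all_boot all_order all_algebra.
From mathcomp Require Import boolp.
From mathcomp Require Import freeg.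

Set Implicit Arguments.
Unset Strict Implicit.
Unset Printing Implicit Defensive.

Import GRing.Theory.
Local Open Scope ring_scope.

Record rng := Rng {
  rng_sort :> zmodType;
  rmul : rng_sort -> rng_sort -> rng_sort;
  rmulA : associative rmul;
  rmulDl : left_distributive rmul +%R;
  rmulDr : right_distributive rmul +%R }.

Definition rng_of (A : pzRingType) : rng := Rng (@mulrA A) (@mulrDl A) (@mulrDr A).
Coercion rng_of : pzRingType >-> rng.

(* No unitality is required, even when R comes from a unital ring: the unital
   modules are the [urmodule]s below. *)
Record rmodule (R : rng) := RModule {
  rsort :> zmodType;
  ract : rsort -> R -> rsort;
  ractDl : forall x y r, ract (x + y) r = ract x r + ract y r;
  ractDr : forall x r s, ract x (r + s) = ract x r + ract x s;
  ractM : forall x r s, ract x (rmul r s) = ract (ract x r) s }.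

Record lmodule (R : rng) := LModule {
  lsort :> zmodType;
  lact : R -> lsort -> lsort;
  lactDl : forall r s x, lact (r + s) x = lact r x + lact s x;
  lactDr : forall r x y, lact r (x + y) = lact r x + lact r y;
  lactM : forall r s x, lact (rmul r s) x = lact r (lact s x) }.

Record rhom (R : rng) (M N : rmodule R) := RHom {
  rfun :> M -> N;
  rfunB : zmod_morphism rfun;
  rfunZ : forall x r, rfun (ract x r) = ract (rfun x) r }.

Record lhom (R : rng) (M N : lmodule R) := LHom {
  lfun :> M -> N;
  lfunB : zmod_morphism lfun;
  lfunZ : forall r x, lfun (lact r x) = lact r (lfun x) }.

HB.instance Definition _ R (M N : rmodule R) (f : rhom M N) :=
  GRing.isZmodMorphism.Build M N (rfun f) (rfunB f).
HB.instance Definition _ R (M N : lmodule R) (f : lhom M N) :=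
  GRing.isZmodMorphism.Build M N (lfun f) (lfunB f).

Lemma rhom_eq R (M N : rmodule R) (f g : rhom M N) : f =1 g -> f = g.
Proof.
case: f g => [f fB fZ] [g gB gZ] /= /funext fg; case: g / fg in gB gZ *.
by congr RHom; exact: Prop_irrelevance.
Qed.

Definition rhom_id R (M : rmodule R) : rhom M M :=
  @RHom R M M id (fun _ _ => erefl) (fun _ _ => erefl).

Definition lhom_id R (M : lmodule R) : lhom M M :=
  @LHom R M M id (fun _ _ => erefl) (fun _ _ => erefl).

Definition rhom_comp R (M N P : rmodule R) (g : rhom N P) (f : rhom M N) : rhom M P.
Proof.
refine (@RHom R M P (g \o f) _ _).
  by move=> x y /=; rewrite !raddfB.
by move=> x r /=; rewrite !rfunZ.
Defined.

Definition rreg (R : rng) : rmodule R :=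
  @RModule R R (@rmul R) (@rmulDl R) (@rmulDr R) (@rmulA R).

Definition lreg (R : rng) : lmodule R :=
  @LModule R R (@rmul R) (@rmulDl R) (@rmulDr R)
    (fun r s x => esym (rmulA r s x)).

(* [tens M N] is the free abelian group on the pairs (m, n) modulo the subgroup
   [tens_rel] generated by biadditivity and by (mr, n) - (m, rn). *)
Section Tensor.
Variables (R : rng) (M : rmodule R) (N : lmodule R).
Local Notation F := {freeg (M * N)%type}.
Local Notation gen m n := (<< (m, n) >> : F).

Inductive tens_rel : F -> Prop :=
| tens_rel0 : tens_rel 0
| tens_relB x y : tens_rel x -> tens_rel y -> tens_rel (x - y)
| tens_rel_Dl m m' n : tens_rel (gen (m + m') n - (gen m n + gen m' n))
| tens_rel_Dr m n n' : tens_rel (gen m (n + n') - (gen m n + gen m n'))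
| tens_rel_M m r n : tens_rel (gen (ract m r) n - gen m (lact r n)).

Definition tens_pred : {pred F} := fun x => `[< tens_rel x >].

Lemma tens_pred_closed : zmod_closed tens_pred.
Proof.
split=> [|x y]; rewrite !unfold_in; first exact/asboolP/tens_rel0.
by move=> /asboolP hx /asboolP hy; exact/asboolP/tens_relB.
Qed.
HB.instance Definition _ := GRing.isZmodClosed.Build F tens_pred tens_pred_closed.

Definition tens : zmodType := Quotient.quot tens_pred.

Definition pure (m : M) (n : N) : tens := \pi_(Quotient.quot tens_pred)%qT (gen m n).

Lemma pureDl m m' n : pure (m + m') n = pure m n + pure m' n.
Proof.
rewrite /pure -raddfD; apply/eqP; rewrite -Quotient.idealrBE.
exact/asboolP/tens_rel_Dl.
Qed.

Lemma pureDr m n n' : pure m (n + n') = pure m n + pure m n'.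
Proof.
rewrite /pure -raddfD; apply/eqP; rewrite -Quotient.idealrBE.
exact/asboolP/tens_rel_Dr.
Qed.

Lemma pureM m r n : pure (ract m r) n = pure m (lact r n).
Proof.
apply/eqP; rewrite -Quotient.idealrBE.
exact/asboolP/tens_rel_M.
Qed.

Lemma pure0r m : pure m 0 = 0.
Proof. by apply: (addrI (pure m 0)); rewrite -pureDr !addr0. Qed.

Lemma pureNr m n : pure m (- n) = - pure m n.
Proof. by apply: (addrI (pure m n)); rewrite -pureDr !subrr pure0r. Qed.

Lemma tens_ind (P : tens -> Prop) :
  (forall m n, P (pure m n)) -> (forall x y, P x -> P y -> P (x + y)) ->
  forall t, P t.
Proof.
move=> Pp PD t.
have P0 : P 0 by rewrite -(pure0r 0).
have PN m n : P (- pure m n) by rewrite -pureNr.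
rewrite -[t]reprK -[repr t]freeg_sumE raddf_sum.
apply: big_ind => // -[m n] _.
move: (coeff _ _) => k.
have -> : << k *g (m, n) >> = << (m, n) >> *~ k :> F by rewrite freegU_mulz intz.
rewrite raddfMz; change (P (pure m n *~ k)).
elim: k => [|k IH|k IH]; first by rewrite mulr0z.
  by rewrite intS mulrzDr mulr1z; apply: (PD).
by rewrite intS opprD mulrzDr mulrNz mulr1z; apply: (PD).
Qed.

Record balanced (P : zmodType) := Balanced {
  bfun :> M -> N -> P;
  balDl : forall m m' n, bfun (m + m') n = bfun m n + bfun m' n;
  balDr : forall m n n', bfun m (n + n') = bfun m n + bfun m n';
  balM : forall m r n, bfun (ract m r) n = bfun m (lact r n) }.

Section Lift.
Variables (P : zmodType) (f : balanced P).

(* [fglift] wants a Z-module, hence the alias [zmodule P]. *)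
Definition tlift (t : tens) : P :=
  fglift (fun mn : (M * N)%type => f mn.1 mn.2 : zmodule P) (repr t).

Let L := fglift (fun mn : (M * N)%type => f mn.1 mn.2 : zmodule P).

Let L_gen m n : L (gen m n) = f m n.
Proof. by rewrite /L liftU scale1r. Qed.

Let LB x y : L (x - y) = L x - L y.
Proof. exact: (lift_is_additive (fun mn : (M * N)%type => f mn.1 mn.2 : zmodule P)). Qed.

Let L_rel x : tens_rel x -> L x = 0.
Proof.
have L0 : L 0 = 0 by rewrite -(subrr (0 : F)) LB subrr.
have LD u v : L (u + v) = L u + L v.
  by rewrite -[v in LHS]opprK LB -(sub0r v) LB L0 sub0r opprK.
elim=> [|u v _ hu _ hv|m m' n|m n n'|m r n].
- exact: L0.
- by rewrite LB hu hv subrr.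
- by rewrite LB LD !L_gen balDl subrr.
- by rewrite LB LD !L_gen balDr subrr.
- by rewrite LB !L_gen balM subrr.
Qed.

Let L_pi x : tlift (\pi_(Quotient.quot tens_pred)%qT x) = L x.
Proof.
apply/eqP; rewrite -subr_eq0 -[tlift _]/(L _) -LB; apply/eqP.
apply: L_rel; apply/asboolP; rewrite -[asbool _]/(_ \in tens_pred).
by rewrite Quotient.idealrBE reprK.
Qed.

Lemma tlift_pure m n : tlift (pure m n) = f m n.
Proof. by rewrite L_pi L_gen. Qed.

Lemma tlift_zmod_morphism : zmod_morphism tlift.
Proof.
move=> x y; rewrite -[x]reprK -[y]reprK -raddfB !L_pi.
exact: LB.
Qed.
HB.instance Definition _ := GRing.isZmodMorphism.Build tens P tlift tlift_zmod_morphism.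

Lemma tliftD x y : tlift (x + y) = tlift x + tlift y.
Proof. exact: raddfD. Qed.

End Lift.

End Tensor.

Lemma tens_eq R (M : rmodule R) (N : lmodule R) (P : zmodType)
    (f g : {additive tens M N -> P}) :
  (forall m n, f (pure m n) = g (pure m n)) -> f =1 g.
Proof. by move=> fg; elim/tens_ind=> // x y hx hy; rewrite !raddfD hx hy. Qed.

Section TensorMap.
Variables (R : rng) (M M' : rmodule R) (N N' : lmodule R).
Variables (f : rhom M M') (g : lhom N N').

Definition tmap_bal : balanced M N (tens M' N').
Proof.
refine (@Balanced R M N _ (fun m n => pure (f m) (g n)) _ _ _).
- by move=> m m' n; rewrite raddfD pureDl.
- by move=> m n n'; rewrite raddfD pureDr.
- by move=> m r n; rewrite rfunZ lfunZ pureM.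
Defined.

Definition tmap : {additive tens M N -> tens M' N'} := tlift tmap_bal.

Lemma tmap_pure m n : tmap (pure m n) = pure (f m) (g n).
Proof. exact: tlift_pure. Qed.

End TensorMap.

Section MultiplicationMaps.
Variable R : rng.

Definition mulr_map (M : rmodule R) : {additive tens M (lreg R) -> M} :=
  tlift (@Balanced R M (lreg R) M (@ract R M) (@ractDl R M) (@ractDr R M)
           (fun m r s => esym (ractM m r s))).

Definition mull_map (N : lmodule R) : {additive tens (rreg R) N -> N} :=
  tlift (@Balanced R (rreg R) N N (@lact R N) (@lactDl R N) (@lactDr R N)
           (fun r s n => lactM r s n)).

Lemma mulr_map_pure M m r : mulr_map M (pure m r) = ract m r.
Proof. exact: tlift_pure. Qed.

Lemma mull_map_pure N r n : mull_map N (pure r n) = lact r n.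
Proof. exact: tlift_pure. Qed.

End MultiplicationMaps.

Definition firm R (M : rmodule R) : Prop := bijective (mulr_map M).

Definition firm_rng (R : rng) : Prop := firm (rreg R).

Lemma firm_inv_ex R (hR : firm_rng R) :
  exists d : R -> tens (rreg R) (lreg R),
    cancel (mulr_map (rreg R)) d /\ cancel d (mulr_map (rreg R)).
Proof. by case: hR => d h1 h2; exists d. Qed.

Definition dmap R (hR : firm_rng R) : R -> tens (rreg R) (lreg R) :=
  proj1_sig (cid (firm_inv_ex hR)).

Lemma mulK R (hR : firm_rng R) : cancel (mulr_map (rreg R)) (dmap hR).
Proof. by rewrite /dmap; case: cid => d []. Qed.

Lemma dmapK R (hR : firm_rng R) : cancel (dmap hR) (mulr_map (rreg R)).
Proof. by rewrite /dmap; case: cid => d []. Qed.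

Lemma dmap_mul R (hR : firm_rng R) (a b : R) :
  dmap hR (rmul a b) = pure (a : rreg R) (b : lreg R).
Proof. by rewrite -(mulK hR (pure _ _)) mulr_map_pure. Qed.

Lemma dmapB R (hR : firm_rng R) : zmod_morphism (dmap hR).
Proof.
move=> x y; rewrite -{1}(dmapK hR x) -{1}(dmapK hR y) -raddfB.
by rewrite mulK.
Qed.
HB.instance Definition _ R (hR : firm_rng R) :=
  GRing.isZmodMorphism.Build R (tens (rreg R) (lreg R)) (dmap hR) (dmapB hR).

Lemma firm_rng_ind R (hR : firm_rng R) (P : R -> Prop) :
  (forall a b, P (rmul a b)) -> (forall x y, P x -> P y -> P (x + y)) ->
  forall r, P r.
Proof.
move=> Pm PD r; rewrite -(dmapK hR r); elim/tens_ind: (dmap hR r) => [a b|x y hx hy].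
  by rewrite mulr_map_pure; exact: Pm.
by rewrite raddfD; exact: PD.
Qed.

Lemma zmod_morphismMz (U V : zmodType) (f : U -> V) :
  zmod_morphism f -> forall u x, f (u *~ x) = f u *~ x.
Proof.
move=> fB u x; pose fA := GRing.isZmodMorphism.Build U V f fB.
pose g : {additive U -> V} := HB.pack f fA.
exact: (raddfMz g).
Qed.

Definition dorroh_sort (R : rng) : Type := (R * int)%type.

Section Dorroh.
Variable R : rng.

HB.instance Definition _ := GRing.Zmodule.copy (dorroh_sort R) (R * int)%type.

Definition dorroh_one : dorroh_sort R := (0, 1).
Definition dorroh_mul (a b : dorroh_sort R) : dorroh_sort R :=
  (rmul a.1 b.1 + a.1 *~ b.2 + b.1 *~ a.2, a.2 * b.2).

Lemma ractMzl (M : rmodule R) (m : M) r x : ract (m *~ x) r = ract m r *~ x.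
Proof.
apply: (zmod_morphismMz (f := fun m : M => ract m r)) => u v.
by apply: (addIr (ract v r)); rewrite -ractDl !subrK.
Qed.

Lemma ractMzr (M : rmodule R) (m : M) (r : R) x : ract m (r *~ x) = ract m r *~ x.
Proof.
apply: (zmod_morphismMz (f := fun r : R => ract m r)) => u v.
by apply: (addIr (ract m v)); rewrite -ractDr !subrK.
Qed.

Lemma lactMzl (N : lmodule R) (n : N) (r : R) x : lact (r *~ x) n = lact r n *~ x.
Proof.
apply: (zmod_morphismMz (f := fun r : R => lact r n)) => u v.
by apply: (addIr (lact v n)); rewrite -lactDl !subrK.
Qed.

Lemma lactMzr (N : lmodule R) (n : N) r x : lact r (n *~ x) = lact r n *~ x.
Proof.
apply: (zmod_morphismMz (f := fun n : N => lact r n)) => u v.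
by apply: (addIr (lact r v)); rewrite -lactDr !subrK.
Qed.

Lemma ract0 (M : rmodule R) (m : M) : ract m 0 = 0.
Proof. by apply: (addrI (ract m 0)); rewrite -ractDr !addr0. Qed.

Lemma lact0 (N : lmodule R) (n : N) : lact 0 n = 0.
Proof. by apply: (addrI (lact 0 n)); rewrite -lactDl !addr0. Qed.

Lemma ract_mul (M : rmodule R) (m : M) (a b : dorroh_sort R) :
  ract m (dorroh_mul a b).1 + m *~ (dorroh_mul a b).2 =
  ract (ract m a.1 + m *~ a.2) b.1 + (ract m a.1 + m *~ a.2) *~ b.2.
Proof.
rewrite /= !ractDr ractM !ractDl ractMzl !ractMzr mulrzDl mulrzA -!addrA.
by congr (_ + _); rewrite addrCA.
Qed.

Lemma lact_mul (N : lmodule R) (n : N) (a b : dorroh_sort R) :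
  lact (dorroh_mul a b).1 n + n *~ (dorroh_mul a b).2 =
  lact a.1 (lact b.1 n + n *~ b.2) + (lact b.1 n + n *~ b.2) *~ a.2.
Proof.
rewrite /= !lactDl lactM !lactDr lactMzr !lactMzl mulrzDl [(_ * _)%R]mulrC mulrzA -!addrA.
by [].
Qed.

Lemma dorroh_mulA : associative dorroh_mul.
Proof.
move=> a b c; congr pair; last exact: mulrA.
rewrite (ract_mul (a.1 : rreg R) b c) /=.
rewrite [in RHS]rmulDl [in RHS]mulrzDl -[rmul (b.1 *~ _) c.1]/(ract (_ : rreg R) _) ractMzl.
rewrite [in RHS]addrACA -[RHS]addrA; congr (_ + _).
by rewrite !mulrzDl -!mulrzA [c.2 * _]mulrC [b.2 * _]mulrC.
Qed.

Lemma dorroh_mul1l : left_id dorroh_one dorroh_mul.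
Proof.
move=> [a x]; rewrite /dorroh_mul /= mul1r mulr1z mul0rz addr0.
by rewrite -[rmul 0 a]/(lact 0 (a : lreg R)) lact0 add0r.
Qed.

Lemma dorroh_mul1r : right_id dorroh_one dorroh_mul.
Proof.
move=> [a x]; rewrite /dorroh_mul /= mulr1 mulr1z mul0rz addr0.
by rewrite -[rmul a 0]/(ract (a : rreg R) 0) ract0 add0r.
Qed.

Lemma dorroh_mulDl : left_distributive dorroh_mul +%R.
Proof.
move=> [a x] [b y] [c z]; congr pair; rewrite /= ?mulrDl //.
by rewrite rmulDl mulrzDl mulrzDr [RHS]addrACA; congr (_ + _); rewrite addrACA.
Qed.

Lemma dorroh_mulDr : right_distributive dorroh_mul +%R.
Proof.
move=> [a x] [b y] [c z]; congr pair; rewrite /= ?mulrDr //.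
by rewrite rmulDr mulrzDl mulrzDr [RHS]addrACA; congr (_ + _); rewrite addrACA.
Qed.

Lemma dorroh_oner_neq0 : dorroh_one != 0.
Proof. by apply/eqP => -[]. Qed.

HB.instance Definition _ := GRing.Zmodule_isNzRing.Build (dorroh_sort R)
  dorroh_mulA dorroh_mul1l dorroh_mul1r dorroh_mulDl dorroh_mulDr dorroh_oner_neq0.

End Dorroh.

Definition dorroh (R : rng) : pzRingType := dorroh_sort R.

Section DorrohModules.
Variable R : rng.

Definition dorroh_r (M : rmodule R) : rmodule (dorroh R).
Proof.
refine (@RModule (dorroh R) M (fun m a => ract m a.1 + m *~ a.2) _ _ _).
- by move=> m m' a; rewrite ractDl mulrzDl addrACA.
- by move=> m a b; rewrite ractDr mulrzDr addrACA.
- by move=> m a b; exact: ract_mul.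
Defined.

Definition dorroh_l (N : lmodule R) : lmodule (dorroh R).
Proof.
refine (@LModule (dorroh R) N (fun a n => lact a.1 n + n *~ a.2) _ _ _).
- by move=> a b n; rewrite lactDl mulrzDr addrACA.
- by move=> a m n; rewrite lactDr mulrzDl addrACA.
- by move=> a b n; exact: lact_mul.
Defined.

(* The canonical map from the tensor product over R to the one over its Dorroh
   extension, sending m (x) n to m (x) n. *)
Definition tens_dorroh_bal (M : rmodule R) (N : lmodule R) :
  balanced M N (tens (dorroh_r M) (dorroh_l N)).
Proof.
refine (@Balanced R M N _ (@pure _ (dorroh_r M) (dorroh_l N)) _ _ _).
- by move=> m m' n; rewrite -pureDl.
- by move=> m n n'; rewrite -pureDr.
- move=> m r n; have := @pureM _ (dorroh_r M) (dorroh_l N) m (r, 0) n.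
  by rewrite /= !mulr0z !addr0.
Defined.

Definition tens_dorroh (M : rmodule R) (N : lmodule R) :
  {additive tens M N -> tens (dorroh_r M) (dorroh_l N)} := tlift (tens_dorroh_bal M N).

Lemma tens_dorroh_pure M N m n :
  tens_dorroh M N (pure m n) = @pure _ (dorroh_r M) (dorroh_l N) m n.
Proof. exact: tlift_pure. Qed.

End DorrohModules.

Record urmodule (A : pzRingType) := URModule {
  ursort :> rmodule A;
  ract1 : forall x : ursort, ract x (1 : A) = x }.

Record bimodule (A : pzRingType) := Bimodule {
  bsort :> urmodule A;
  blact : A -> bsort -> bsort;
  blactDl : forall a b x, blact (a + b) x = blact a x + blact b x;
  blactDr : forall a x y, blact a (x + y) = blact a x + blact a y;
  blactM : forall a b x, blact (a * b) x = blact a (blact b x);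
  blact1 : forall x, blact 1 x = x;
  blactC : forall (a : A) x (b : A), ract (blact a x) b = blact a (ract x b) }.

Definition bimodule_l A (C : bimodule A) : lmodule A :=
  @LModule A C (@blact A C) (@blactDl A C) (@blactDr A C) (@blactM A C).
Coercion bimodule_l : bimodule >-> lmodule.
Canonical bimodule_l.

Record bhom (A : pzRingType) (C D : bimodule A) := BHom {
  bhom_r :> rhom C D;
  bhomZ : forall (a : A) (x : C), bhom_r (blact a x) = blact a (bhom_r x) }.

Definition bhom_l A (C D : bimodule A) (f : bhom C D) : lhom C D :=
  @LHom A C D f (rfunB f) (@bhomZ A C D f).
Coercion bhom_l : bhom >-> lhom.

Definition breg (A : pzRingType) : bimodule A :=
  @Bimodule A (@URModule A (rreg A) (@mulr1 A)) *%R (@lactDl A (lreg A))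
    (@lactDr A (lreg A)) (@lactM A (lreg A)) (@mul1r A)
    (fun a x b => esym (mulrA a x b)).

Section TensorModules.
Variable A : pzRingType.

Definition tens_ract_bal (M : rmodule A) (C : bimodule A) (a : A) :
  balanced M C (tens M C).
Proof.
refine (@Balanced A M C _ (fun (m : M) (c : C) => pure m (ract c a : C)) _ _ _).
- by move=> m m' c; rewrite pureDl.
- by move=> m c c'; rewrite ractDl pureDr.
- by move=> m r c; rewrite pureM /= blactC.
Defined.

Definition tens_ract (M : rmodule A) (C : bimodule A) (t : tens M C) (a : A) :
  tens M C := tlift (tens_ract_bal M C a) t.

Lemma tens_ract_pure M (C : bimodule A) m (c : C) a :
  tens_ract (pure m c) a = pure m (ract c a : C) :> tens M C.
Proof. exact: tlift_pure. Qed.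

Lemma tens_ractDl M (C : bimodule A) (x y : tens M C) a :
  tens_ract (x + y) a = tens_ract x a + tens_ract y a.
Proof. by rewrite /tens_ract raddfD. Qed.

Lemma tens_ractDr M (C : bimodule A) (x : tens M C) (a b : A) :
  tens_ract x (a + b) = tens_ract x a + tens_ract x b.
Proof.
elim/tens_ind: x => [m c|x y hx hy]; last by rewrite !tens_ractDl hx hy addrACA.
by rewrite !tens_ract_pure ractDr pureDr.
Qed.

Lemma tens_ractM M (C : bimodule A) (x : tens M C) (a b : A) :
  tens_ract x (a * b) = tens_ract (tens_ract x a) b.
Proof.
elim/tens_ind: x => [m c|x y hx hy]; last by rewrite !tens_ractDl hx hy.
by rewrite !tens_ract_pure; congr pure; exact: ractM.
Qed.

Lemma tens_ract1 M (C : bimodule A) (x : tens M C) : tens_ract x 1 = x.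
Proof.
elim/tens_ind: x => [m c|x y hx hy]; last by rewrite !tens_ractDl hx hy.
by rewrite !tens_ract_pure ract1.
Qed.

Definition rtens (M : rmodule A) (C : bimodule A) : urmodule A :=
  @URModule A
    (@RModule A (tens M C) (@tens_ract M C) (@tens_ractDl M C) (@tens_ractDr M C)
       (@tens_ractM M C))
    (@tens_ract1 M C).

Definition tens_lact_bal (C D : bimodule A) (a : A) : balanced C D (tens C D).
Proof.
refine (@Balanced A C D _ (fun (c : C) (d : D) => pure (blact a c : C) d) _ _ _).
- by move=> c c' d; rewrite blactDr pureDl.
- by move=> c d d'; rewrite pureDr.
- by move=> c r d; rewrite -blactC pureM.
Defined.

Definition tens_lact (C D : bimodule A) (a : A) (t : tens C D) : tens C D :=
  tlift (tens_lact_bal C D a) t.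

Lemma tens_lact_pure (C D : bimodule A) a (c : C) (d : D) :
  tens_lact a (pure c d) = pure (blact a c : C) d :> tens C D.
Proof. exact: tlift_pure. Qed.

Lemma tens_lactDr (C D : bimodule A) a (x y : tens C D) :
  tens_lact a (x + y) = tens_lact a x + tens_lact a y.
Proof. by rewrite /tens_lact raddfD. Qed.

Lemma tens_lactDl (C D : bimodule A) (a b : A) (x : tens C D) :
  tens_lact (a + b) x = tens_lact a x + tens_lact b x.
Proof.
elim/tens_ind: x => [m c|x y hx hy]; last by rewrite !tens_lactDr hx hy addrACA.
by rewrite !tens_lact_pure blactDl pureDl.
Qed.

Lemma tens_lactM (C D : bimodule A) (a b : A) (x : tens C D) :
  tens_lact (a * b) x = tens_lact a (tens_lact b x).
Proof.
elim/tens_ind: x => [m c|x y hx hy]; last by rewrite !tens_lactDr hx hy.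
by rewrite !tens_lact_pure blactM.
Qed.

Lemma tens_lact1 (C D : bimodule A) (x : tens C D) : tens_lact 1 x = x.
Proof.
elim/tens_ind: x => [m c|x y hx hy]; last by rewrite !tens_lactDr hx hy.
by rewrite !tens_lact_pure blact1.
Qed.

Lemma tens_lactC (C D : bimodule A) (a : A) (x : tens C D) (b : A) :
  tens_ract (tens_lact a x) b = tens_lact a (tens_ract x b).
Proof.
elim/tens_ind: x => [m c|x y hx hy].
  by rewrite tens_lact_pure !tens_ract_pure tens_lact_pure.
by rewrite !(tens_ractDl, tens_lactDr) hx hy.
Qed.

Definition btens (C D : bimodule A) : bimodule A :=
  @Bimodule A (rtens C D) (@tens_lact C D) (@tens_lactDl C D) (@tens_lactDr C D)
    (@tens_lactM C D) (@tens_lact1 C D) (@tens_lactC C D).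

Section Associator.
Variables (M : rmodule A) (C D : bimodule A).

Definition tassoc_bal1 (d : D) : balanced M C (tens M (btens C D)).
Proof.
refine (@Balanced A M C _
  (fun (m : M) (c : C) => pure m (pure c d : btens C D)) _ _ _).
- by move=> m m' c; rewrite pureDl.
- by move=> m c c'; rewrite (pureDl c c' d) pureDr.
- by move=> m r c; rewrite pureM /= tens_lact_pure.
Defined.

Definition tassoc_bal2 : balanced (rtens M C) D (tens M (btens C D)).
Proof.
refine (@Balanced A (rtens M C) D _
  (fun (t : rtens M C) (d : D) => tlift (tassoc_bal1 d) t) _ _ _).
- by move=> t t' d; rewrite raddfD.
- move=> t d d'; elim/tens_ind: t => [m c|x y hx hy].
    by rewrite !tlift_pure /= (pureDr c d d') pureDr.
  by rewrite !tliftD hx hy addrACA.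
- move=> t a d /=; elim/tens_ind: t => [m c|x y hx hy].
    by rewrite tens_ract_pure !tlift_pure /= (pureM c a d).
  by rewrite tens_ractDl !tliftD hx hy.
Defined.

Definition tassoc : {additive tens (rtens M C) D -> tens M (btens C D)} :=
  tlift tassoc_bal2.

Lemma tassoc_pure (m : M) (c : C) (d : D) :
  tassoc (pure (pure m c : rtens M C) d) = pure m (pure c d : btens C D).
Proof. by rewrite [LHS](tlift_pure tassoc_bal2) /= tlift_pure. Qed.

End Associator.

End TensorModules.

(* Coassociativity is compared along [tassoc], and the two counit laws along the
   isomorphisms A (x) C -> C and C (x) A -> C. *)
Record coring (A : pzRingType) := Coring {
  coring_bimod :> bimodule A;
  comul : bhom coring_bimod (btens coring_bimod coring_bimod);
  counit : bhom coring_bimod (breg A);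
  coassoc : forall c,
    tassoc coring_bimod coring_bimod coring_bimod (tmap comul (lhom_id coring_bimod) (comul c))
    = tmap (rhom_id coring_bimod) comul (comul c);
  counitl : forall c, mull_map coring_bimod (tmap counit (lhom_id coring_bimod) (comul c)) = c;
  counitr : forall c, mulr_map coring_bimod (tmap (rhom_id coring_bimod) counit (comul c)) = c }.

Record comodule (A : pzRingType) (C : coring A) := Comodule {
  comod_mod :> urmodule A;
  coact : rhom comod_mod (rtens comod_mod C);
  coactA : forall m,
    tassoc comod_mod C C (tmap coact (lhom_id C) (coact m)) =
    tmap (rhom_id comod_mod) (comul C) (coact m);
  coact1 : forall m, mulr_map comod_mod (tmap (rhom_id comod_mod) (counit C) (coact m)) = m }.

Record comod_hom (A : pzRingType) (C : coring A) (M N : comodule C) := ComodHom {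
  comod_fun :> rhom M N;
  comod_funP : forall m, coact N (comod_fun m) = tmap comod_fun (lhom_id C) (coact M m) }.

Section DorrohCoring.
Variables (R : rng) (hR : firm_rng R).

Lemma dorroh_r1 (M : rmodule R) (x : dorroh_r M) : @ract (dorroh R) _ x (1 : dorroh R) = x.
Proof. by rewrite /= ract0 add0r mulr1z. Qed.

Lemma dorroh_l1 (N : lmodule R) (x : dorroh_l N) : @lact (dorroh R) _ (1 : dorroh R) x = x.
Proof. by rewrite /= lact0 add0r mulr1z. Qed.

Lemma dorroh_bimodC (a : dorroh R) (x : R) (b : dorroh R) :
  @ract _ (dorroh_r (rreg R)) (@lact _ (dorroh_l (lreg R)) a x) b =
  @lact _ (dorroh_l (lreg R)) a (@ract _ (dorroh_r (rreg R)) x b).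
Proof.
rewrite /= rmulDl rmulDr rmulA !mulrzDl -!addrA; congr (_ + _).
rewrite -[rmul (x *~ _) _]/(ract (_ : rreg R) _) ractMzl /=.
rewrite -[rmul _ (x *~ _)]/(ract (_ : rreg R) (_ : R)) ractMzr /=.
by rewrite addrCA -!mulrzA [(a.2 * _)%R]mulrC.
Qed.

Definition dorroh_bimod : bimodule (dorroh R) :=
  @Bimodule (dorroh R) (@URModule (dorroh R) (dorroh_r (rreg R)) (@dorroh_r1 (rreg R)))
    (@lact _ (dorroh_l (lreg R))) (@lactDl _ (dorroh_l (lreg R)))
    (@lactDr _ (dorroh_l (lreg R))) (@lactM _ (dorroh_l (lreg R)))
    (@dorroh_l1 (lreg R)) dorroh_bimodC.

Definition iota_fun (r : dorroh_bimod) : breg (dorroh R) := (r, 0).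

Lemma iotaB : zmod_morphism iota_fun.
Proof. by move=> x y; congr pair; rewrite subr0. Qed.

Lemma iotaZr (x : dorroh_bimod) (a : dorroh R) :
  iota_fun (ract x a) = ract (iota_fun x) a.
Proof. by congr pair; rewrite /= ?mul0r // mulr0z addr0. Qed.

Lemma iotaZl (a : dorroh R) (x : dorroh_bimod) :
  iota_fun (blact a x) = blact a (iota_fun x).
Proof. by congr pair; rewrite /= ?mulr0 // mulr0z addr0. Qed.

Definition dorroh_counit : bhom dorroh_bimod (breg (dorroh R)) :=
  @BHom _ _ _ (RHom iotaB iotaZr) iotaZl.

Definition comul_fun (r : dorroh_bimod) : btens dorroh_bimod dorroh_bimod :=
  tens_dorroh (rreg R) (lreg R) (dmap hR r).

Lemma comul_fun_mul (a b : R) :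
  comul_fun (rmul a b) = @pure _ dorroh_bimod dorroh_bimod a b.
Proof. by rewrite /comul_fun dmap_mul tens_dorroh_pure. Qed.

Lemma comulB : zmod_morphism comul_fun.
Proof. by move=> x y; rewrite /comul_fun !raddfB. Qed.

Lemma comulD (x y : dorroh_bimod) : comul_fun (x + y) = comul_fun x + comul_fun y.
Proof. by rewrite /comul_fun !raddfD. Qed.

Lemma comulZr (x : dorroh_bimod) (a : dorroh R) :
  comul_fun (ract x a) = ract (comul_fun x) a.
Proof.
elim/(firm_rng_ind hR): x => [u v|x y hx hy].
  have -> : @ract _ dorroh_bimod (rmul u v) a = rmul u (@ract _ dorroh_bimod v a).
    by rewrite /= rmulDr rmulA -[rmul _ (v *~ _)]/(ract (_ : rreg R) (_ : R)) ractMzr.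
  by rewrite !comul_fun_mul; exact: (esym (tens_ract_pure (C := dorroh_bimod) _ _ _)).
by rewrite (@ractDl _ dorroh_bimod) comulD hx hy comulD -ractDl.
Qed.

Lemma comulZl (a : dorroh R) (x : dorroh_bimod) :
  comul_fun (blact a x) = blact a (comul_fun x).
Proof.
elim/(firm_rng_ind hR): x => [u v|x y hx hy].
  have -> : @blact _ dorroh_bimod a (rmul u v) = rmul (@blact _ dorroh_bimod a u) v.
    by rewrite /= rmulDl rmulA -[rmul (u *~ _) v]/(ract (_ : rreg R) _) ractMzl.
  rewrite !comul_fun_mul.
  exact: (esym (tens_lact_pure (C := dorroh_bimod) (D := dorroh_bimod) _ _ _)).
by rewrite (@blactDr _ dorroh_bimod) comulD hx hy comulD -blactDr.
Qed.

Definition dorroh_comul : bhom dorroh_bimod (btens dorroh_bimod dorroh_bimod) :=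
  @BHom _ _ _ (RHom comulB comulZr) comulZl.

Lemma dorroh_coassoc (c : dorroh_bimod) :
  tassoc dorroh_bimod dorroh_bimod dorroh_bimod
    (tmap dorroh_comul (lhom_id dorroh_bimod) (dorroh_comul c))
  = tmap (rhom_id dorroh_bimod) dorroh_comul (dorroh_comul c).
Proof.
elim/(firm_rng_ind hR): c => [u v|x y hx hy]; last by rewrite !raddfD hx hy.
rewrite [dorroh_comul _]comul_fun_mul !tmap_pure.
change (tassoc dorroh_bimod dorroh_bimod dorroh_bimod
    (@pure _ (rtens dorroh_bimod dorroh_bimod) dorroh_bimod (comul_fun u) v) =
  @pure _ dorroh_bimod (btens dorroh_bimod dorroh_bimod) u (comul_fun v)).
elim/(firm_rng_ind hR): u => [s t|x y hx hy]; last first.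
  rewrite comulD (@pureDl _ (rtens dorroh_bimod dorroh_bimod)) raddfD hx hy.
  by rewrite -(@pureDl _ dorroh_bimod).
rewrite comul_fun_mul tassoc_pure -comul_fun_mul.
have -> : @pure _ dorroh_bimod (btens dorroh_bimod dorroh_bimod) (rmul s t) (comul_fun v) =
          @pure _ dorroh_bimod (btens dorroh_bimod dorroh_bimod)
            (@ract _ dorroh_bimod s (t, 0)) (comul_fun v).
  by congr pure; rewrite /= mulr0z addr0.
rewrite pureM -[lact _ _]comulZl; congr (pure _ (comul_fun _)).
by rewrite /= mulr0z addr0.
Qed.

Lemma dorroh_counitl (c : dorroh_bimod) :
  mull_map dorroh_bimod (tmap dorroh_counit (lhom_id dorroh_bimod) (dorroh_comul c)) = c.
Proof.
elim/(firm_rng_ind hR): c => [u v|x y hx hy]; last by rewrite !raddfD hx hy.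
rewrite [dorroh_comul _]comul_fun_mul tmap_pure.
rewrite [LHS](mull_map_pure (N := dorroh_bimod)) /=.
by rewrite mulr0z addr0.
Qed.

Lemma dorroh_counitr (c : dorroh_bimod) :
  mulr_map dorroh_bimod (tmap (rhom_id dorroh_bimod) dorroh_counit (dorroh_comul c)) = c.
Proof.
elim/(firm_rng_ind hR): c => [u v|x y hx hy]; last by rewrite !raddfD hx hy.
rewrite [dorroh_comul _]comul_fun_mul tmap_pure.
rewrite [LHS](mulr_map_pure (M := dorroh_bimod)) /=.
by rewrite mulr0z addr0.
Qed.

Definition dorroh_coring : coring (dorroh R) :=
  @Coring (dorroh R) dorroh_bimod dorroh_comul dorroh_counit
    dorroh_coassoc dorroh_counitl dorroh_counitr.

End DorrohCoring.

Record category := Category {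
  obj :> Type;
  hom : obj -> obj -> Type;
  idm : forall X, hom X X;
  compm : forall X Y Z, hom Y Z -> hom X Y -> hom X Z;
  comp1m : forall X Y (f : hom X Y), compm (idm Y) f = f;
  compm1 : forall X Y (f : hom X Y), compm f (idm X) = f;
  compmA : forall X Y Z W (h : hom Z W) (g : hom Y Z) (f : hom X Y),
    compm h (compm g f) = compm (compm h g) f }.

Record functor (C D : category) := Functor {
  fobj :> C -> D;
  fhom : forall X Y, hom X Y -> hom (fobj X) (fobj Y);
  fhom1 : forall X, fhom (idm X) = idm (fobj X);
  fhomM : forall X Y Z (g : hom Y Z) (f : hom X Y),
    fhom (compm g f) = compm (fhom g) (fhom f) }.

Definition functor_id (C : category) : functor C C :=
  @Functor C C id (fun X Y f => f) (fun X => erefl) (fun X Y Z g f => erefl).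

Definition functor_comp (C D E : category) (G : functor D E) (F : functor C D) :
  functor C E.
Proof.
refine (@Functor C E (fun X => G (F X)) (fun X Y f => fhom G (fhom F f)) _ _).
  by move=> X; rewrite !fhom1.
by move=> X Y Z g f; rewrite !fhomM.
Defined.

Definition cat_isomorphic (C D : category) : Prop :=
  exists (F : functor C D) (G : functor D C),
    functor_comp G F = functor_id C /\ functor_comp F G = functor_id D.

Record firm_module (R : rng) := FirmModule {
  firm_mod :> rmodule R;
  firm_modP : firm firm_mod }.

Definition firm_cat (R : rng) : category.
Proof.
refine (@Category (firm_module R) (fun M N => rhom M N)
  (fun M => rhom_id M) (fun M N P g f => rhom_comp g f) _ _ _).
- by move=> M N f; exact: rhom_eq.
- by move=> M N f; exact: rhom_eq.
- by move=> M N P Q h g f; exact: rhom_eq.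
Defined.

Section ComoduleCategory.
Variables (A : pzRingType) (C : coring A).

Lemma comod_hom_eq (M N : comodule C) (f g : comod_hom M N) : f =1 g -> f = g.
Proof.
case: f g => [f fP] [g gP] /= /rhom_eq fg; case: g / fg gP => gP.
by congr ComodHom; exact: Prop_irrelevance.
Qed.

Definition comod_id (M : comodule C) : comod_hom M M.
Proof.
refine (@ComodHom A C M M (rhom_id M) _) => m.
by apply: (@tens_eq _ _ _ _ idfun) => x c; rewrite tmap_pure.
Defined.

Definition comod_comp (M N P : comodule C) (g : comod_hom N P) (f : comod_hom M N) :
  comod_hom M P.
Proof.
refine (@ComodHom A C M P (rhom_comp g f) _) => m.
rewrite [LHS]comod_funP comod_funP.
apply: (@tens_eq _ _ _ _ (tmap g (lhom_id C) \o tmap f (lhom_id C))) => x c.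
by rewrite /= !tmap_pure.
Defined.

Definition comodule_cat : category.
Proof.
refine (@Category (comodule C) (@comod_hom A C) comod_id comod_comp _ _ _).
- by move=> M N f; exact: comod_hom_eq.
- by move=> M N f; exact: comod_hom_eq.
- by move=> M N P Q h g f; exact: comod_hom_eq.
Defined.

End ComoduleCategory.

(* Main.v *)
From HB Require Import structures.
From mathcomp Require Import all_boot all_order all_algebra.
From mathcomp Require Import boolp.
Require Import Defs.

Set Implicit Arguments.
Unset Strict Implicit.
Unset Printing Implicit Defensive.

Import GRing.Theory.
Local Open Scope ring_scope.

(** A firm module [M] becomes a comodule through the inverse of its
multiplication map, [x r |-> x (x) r].  Conversely, for a comodule [N] with
coaction [n |-> sum n_i (x) r_i], right linearity and the counit law give
[rho (n r) = sum n_i (x) r_i r = sum n_i r_i (x) r = n (x) r], so that [rho]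
inverts the multiplication map of [N] restricted to [R].  Both assignments keep
the underlying abelian groups and maps, hence are mutually inverse on the nose. *)

(** * Additivity of module maps and integer multiples in tensors *)

Lemma rfunD (R : rng) (M N : rmodule R) (f : rhom M N) (x y : M) :
  f (x + y) = f x + f y.
Proof. exact: raddfD. Qed.

Lemma pureMzl (R : rng) (M : rmodule R) (N : lmodule R) (m : M) (n : N) x :
  pure (m *~ x) n = pure m n *~ x.
Proof.
apply: (zmod_morphismMz (f := fun m : M => pure m n)) => u v.
by apply: (addIr (pure v n)); rewrite -pureDl !subrK.
Qed.

Lemma pureMzr (R : rng) (M : rmodule R) (N : lmodule R) (m : M) (n : N) x :
  pure m (n *~ x) = pure m n *~ x.
Proof.
apply: (zmod_morphismMz (f := fun n : N => pure m n)) => u v.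
by apply: (addIr (pure m v)); rewrite -pureDr !subrK.
Qed.

(** * Equality of objects and functors *)

Definition idtohom (C : category) (X Y : C) (e : X = Y) : hom X Y :=
  let: erefl := e in idm X.

(** Once [F] is the identity on objects, each [e X] proves [X = X] and is [erefl] by proof
    irrelevance, so the squares collapse to [fhom F f = f]. *)
Lemma functor_eq_id (C : category) (F : functor C C) (e : forall X, F X = X) :
  (forall X Y (f : hom X Y),
    compm (idtohom (e Y)) (fhom F f) = compm f (idtohom (e X))) ->
  F = functor_id C.
Proof.
case: F e => F0 F1 F1id F1comp /= e.
have F0E : F0 = id by apply: funext.
subst F0 => F1E.
have {}F1E : F1 = fun X Y f => f.
  apply: functional_extensionality_dep => X.
  apply: functional_extensionality_dep => Y.
  apply: funext => f; have := F1E X Y f.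
  by rewrite (Prop_irrelevance (e X) erefl) (Prop_irrelevance (e Y) erefl)
    comp1m compm1.
by subst F1; congr Functor; exact: Prop_irrelevance.
Qed.

(** Faithfulness of [U] moves the squares to underlying functions. Only the image [i X] of the
    transport matters there, so the proofs [e] may stay opaque. *)
Lemma functor_eq_id_faithful (C : category) (F : functor C C) (U : C -> Type)
    (u : forall X Y, hom X Y -> U X -> U Y)
    (uM : forall X Y Z (g : hom Y Z) (f : hom X Y), u _ _ (compm g f) = u _ _ g \o u _ _ f)
    (u_inj : forall X Y, injective (u X Y))
    (i : forall X, U (F X) -> U X) :
  (forall X, exists e : F X = X, u _ _ (idtohom e) = i X) ->
  (forall X Y (f : hom X Y), i Y \o u _ _ (fhom F f) = u _ _ f \o i X) ->
  F = functor_id C.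
Proof.
move=> ex_e iE.
apply: (functor_eq_id (e := fun X => proj1_sig (cid (ex_e X)))) => X Y f.
apply: u_inj; rewrite !uM.
by case: (cid (ex_e X)) => eX /= ->; case: (cid (ex_e Y)) => eY /= ->.
Qed.

Lemma firm_module_eq (R : rng) (S : zmodType) act1 D1 Dr1 M1 P1 act2 D2 Dr2 M2 P2 :
  act1 = act2 ->
  exists e : @FirmModule R (@RModule R S act1 D1 Dr1 M1) P1 =
             @FirmModule R (@RModule R S act2 D2 Dr2 M2) P2,
    rfun (@idtohom (firm_cat R) _ _ e) = (fun x : S => x).
Proof.
move=> actE; subst act2.
have := Prop_irrelevance D1 D2; have := Prop_irrelevance Dr1 Dr2.
have := Prop_irrelevance M1 M2 => ? ? ?; subst.
have := Prop_irrelevance P1 P2 => ?; subst.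
by exists erefl.
Qed.

(** The types of the coactions depend on the actions, so the two data cannot be compared separately
    at the outset; a comodule map carried by the identity compares both. Its linearity equates the
    actions, then its colinearity the coactions. *)
Lemma comodule_eq (A : pzRingType) (C : coring A) (S : zmodType)
    act1 D1 Dr1 M1 u1 co1 coA1 cou1 act2 D2 Dr2 M2 u2 co2 coA2 cou2
    (M := @Comodule A C (@URModule A (@RModule A S act1 D1 Dr1 M1) u1) co1 coA1 cou1)
    (N := @Comodule A C (@URModule A (@RModule A S act2 D2 Dr2 M2) u2) co2 coA2 cou2)
    (f : comod_hom M N) :
  rfun f = (fun x : S => x) ->
  exists e : M = N, rfun (@idtohom (comodule_cat C) _ _ e) = (fun x : S => x).
Proof.
move=> fE.
have actE : act1 = act2.
  apply: funext => x; apply: funext => r.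
  by have /= := rfunZ f x r; rewrite fE.
subst act2.
have := Prop_irrelevance D1 D2; have := Prop_irrelevance Dr1 Dr2.
have := Prop_irrelevance M1 M2 => ? ? ?; subst.
have := Prop_irrelevance u1 u2 => ?; subst.
have coE : co1 = co2.
  apply: rhom_eq => m; have := comod_funP f m; rewrite fE => coE.
  rewrite [RHS]coE.
  apply: (@tens_eq _ _ _ _ idfun (tmap f (lhom_id C))) => x c.
  by rewrite tmap_pure fE.
subst co2.
have := Prop_irrelevance coA1 coA2; have := Prop_irrelevance cou1 cou2.
by move=> ? ?; subst; exists erefl.
Qed.

(** * Firm modules as comodules *)

Section FirmInverse.
Variables (R : rng) (M : firm_module R).

Lemma firm_inv_subproof : exists d : M -> tens M (lreg R),
  cancel (mulr_map M) d /\ cancel d (mulr_map M).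
Proof. by case: (firm_modP M) => d h1 h2; exists d. Qed.

Definition firm_inv : M -> tens M (lreg R) := proj1_sig (cid firm_inv_subproof).

Lemma mulr_mapK : cancel (mulr_map M) firm_inv.
Proof. by rewrite /firm_inv; case: cid => d []. Qed.

Lemma firm_invK : cancel firm_inv (mulr_map M).
Proof. by rewrite /firm_inv; case: cid => d []. Qed.

Lemma firm_inv_act (m : M) (r : R) : firm_inv (ract m r) = pure m (r : lreg R).
Proof. by rewrite -(mulr_mapK (pure _ _)) mulr_map_pure. Qed.

Lemma firm_invB : zmod_morphism firm_inv.
Proof.
move=> x y; rewrite -{1}(firm_invK x) -{1}(firm_invK y) -raddfB.
by rewrite mulr_mapK.
Qed.
HB.instance Definition _ :=
  GRing.isZmodMorphism.Build M (tens M (lreg R)) firm_inv firm_invB.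

(** The multiplication map is onto, so products generate [M] additively and additive identities need
    only be checked on them. *)
Lemma firm_ind (P : M -> Prop) :
  (forall m r, P (ract m r)) -> (forall x y, P x -> P y -> P (x + y)) ->
  forall m, P m.
Proof.
move=> Pm PD m; rewrite -(firm_invK m).
elim/tens_ind: (firm_inv m) => [a b|x y hx hy].
  by rewrite mulr_map_pure; exact: Pm.
by rewrite raddfD; exact: PD.
Qed.

End FirmInverse.

Section FirmToComodule.
Variables (R : rng) (hR : firm_rng R).
Local Notation C := (dorroh_coring hR).
Local Notation B := (dorroh_bimod R).

Definition dorroh_ur (M : rmodule R) : urmodule (dorroh R) :=
  @URModule (dorroh R) (dorroh_r M) (@dorroh_r1 R M).

(** [R] is an ideal of its Dorroh extension, so the scalar [a] can be absorbed into [r]. *)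
Lemma dorroh_ractA (M : rmodule R) (m : M) (r : R) (a : dorroh R) :
  @ract _ (dorroh_ur M) (ract m r) a = ract m (@ract _ B r a : R).
Proof. by rewrite /= ractDr ractM ractMzr. Qed.

Definition coact_fun (M : firm_module R) (m : dorroh_ur M) : rtens (dorroh_ur M) B :=
  tens_dorroh M (lreg R) (firm_inv m).

Lemma coact_fun_act (M : firm_module R) (m : M) (r : R) :
  coact_fun (ract m r) = @pure _ (dorroh_ur M) B m r.
Proof. by rewrite /coact_fun firm_inv_act tens_dorroh_pure. Qed.

Lemma coact_funB (M : firm_module R) : zmod_morphism (@coact_fun M).
Proof. by move=> x y; rewrite /coact_fun !raddfB. Qed.

Lemma coact_funD (M : firm_module R) (x y : dorroh_ur M) :
  coact_fun (x + y) = coact_fun x + coact_fun y.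
Proof. by rewrite /coact_fun !raddfD. Qed.

Lemma coact_funZ (M : firm_module R) (m : dorroh_ur M) (a : dorroh R) :
  coact_fun (ract m a) = ract (coact_fun m) a.
Proof.
elim/(@firm_ind R M): m => [m r|x y hx hy].
  rewrite dorroh_ractA !coact_fun_act.
  exact: (esym (tens_ract_pure (C := B) _ _ _)).
by rewrite (@ractDl _ (dorroh_ur M)) coact_funD hx hy coact_funD -ractDl.
Qed.

Definition firm_coact (M : firm_module R) : rhom (dorroh_ur M) (rtens (dorroh_ur M) C) :=
  @RHom _ (dorroh_ur M) (rtens (dorroh_ur M) C) _ (@coact_funB M) (@coact_funZ M).

(** On [(m s) r] both sides are [m (x) (s (x) r)]; on the right this uses left linearity of the
    comultiplication, [s d(r) = d(s r)]. *)
Lemma firm_coactA (M : firm_module R) (m : dorroh_ur M) :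
  tassoc (dorroh_ur M) C C (tmap (firm_coact M) (lhom_id C) (firm_coact M m)) =
  tmap (rhom_id (dorroh_ur M)) (comul C) (firm_coact M m).
Proof.
elim/(@firm_ind R M): m => [m r|x y hx hy]; last by rewrite !raddfD hx hy.
rewrite [firm_coact M _]coact_fun_act !tmap_pure.
change (tassoc (dorroh_ur M) B B (@pure _ (rtens (dorroh_ur M) B) B (coact_fun m) r) =
  @pure _ (dorroh_ur M) (btens B B) m (comul_fun hR r)).
(* The coaction is applied a second time, to [m], so [m] must be split into products as well. *)
elim/(@firm_ind R M): m => [m s|x y hx hy]; last first.
  rewrite coact_funD (@pureDl _ (rtens (dorroh_ur M) B)) raddfD hx hy.
  by rewrite -(@pureDl _ (dorroh_ur M)).
rewrite coact_fun_act tassoc_pure -(comul_fun_mul hR).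
(* Written as the scalar [(s, 0)], [s] can cross the tensor sign over the Dorroh extension. *)
have -> : @pure _ (dorroh_ur M) (btens B B) (ract m s) (comul_fun hR r) =
          @pure _ (dorroh_ur M) (btens B B) (@ract _ (dorroh_ur M) m (s, 0)) (comul_fun hR r).
  by congr pure; rewrite /= mulr0z addr0.
rewrite pureM -[lact _ _]comulZl; congr (pure _ (comul_fun _ _)).
by rewrite /= mulr0z addr0.
Qed.

Lemma firm_coact1 (M : firm_module R) (m : dorroh_ur M) :
  mulr_map (dorroh_ur M) (tmap (rhom_id (dorroh_ur M)) (counit C) (firm_coact M m)) = m.
Proof.
elim/(@firm_ind R M): m => [m r|x y hx hy]; last by rewrite !raddfD hx hy.
rewrite [firm_coact M _]coact_fun_act tmap_pure.
rewrite [LHS](mulr_map_pure (M := dorroh_ur M)) /=.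
by rewrite mulr0z addr0.
Qed.

Definition firm_comodule (M : firm_module R) : comodule C :=
  @Comodule _ C (dorroh_ur M) (firm_coact M) (@firm_coactA M) (@firm_coact1 M).

Section Hom.
Variables (M N : firm_module R) (f : rhom M N).

Lemma dorroh_hom_subproof (x : dorroh_ur M) (a : dorroh R) :
  f (ract x a) = @ract _ (dorroh_ur N) (f x) a.
Proof. by rewrite /= -(rfunZ f) -raddfMz -raddfD. Qed.

Definition dorroh_hom : rhom (dorroh_ur M) (dorroh_ur N) :=
  @RHom _ (dorroh_ur M) (dorroh_ur N) f (rfunB f) dorroh_hom_subproof.

(** Linearity alone forces colinearity: [f (m r) = f m r] is sent to [f m (x) r]. *)
Lemma dorroh_hom_coact (m : dorroh_ur M) :
  firm_coact N (dorroh_hom m) = tmap dorroh_hom (lhom_id C) (firm_coact M m).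
Proof.
elim/(@firm_ind R M): m => [m r|x y hx hy]; last first.
  by rewrite !rfunD hx hy raddfD.
rewrite [firm_coact M _]coact_fun_act tmap_pure -[RHS](@coact_fun_act N).
exact: (congr1 (@coact_fun N) (rfunZ f m r)).
Qed.

Definition firm_comod_hom : comod_hom (firm_comodule M) (firm_comodule N) :=
  @ComodHom _ C (firm_comodule M) (firm_comodule N) dorroh_hom dorroh_hom_coact.

End Hom.

Definition firm_to_comod : functor (firm_cat R) (comodule_cat C).
Proof.
refine (@Functor (firm_cat R) (comodule_cat C) firm_comodule firm_comod_hom _ _).
- by move=> M; exact: comod_hom_eq.
- by move=> M N P g f; exact: comod_hom_eq.
Defined.

End FirmToComodule.

(** * Comodules as firm modules *)

Section ComoduleToFirm.
Variables (R : rng) (hR : firm_rng R).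
Local Notation C := (dorroh_coring hR).
Local Notation B := (dorroh_bimod R).

Lemma dorroh_incl_mul (r s : R) :
  ((rmul r s, 0) : dorroh R) = ((r, 0) : dorroh R) * ((s, 0) : dorroh R).
Proof. by congr pair; rewrite /= ?mulr0z ?addr0 ?mulr0. Qed.

(** Restriction of scalars along the non-unital inclusion of [R]. *)
Definition restr (N : urmodule (dorroh R)) : rmodule R.
Proof.
refine (@RModule R N (fun n r => ract n ((r, 0) : dorroh R)) _ _ _).
- by move=> x y r; rewrite ractDl.
- by move=> x r s; rewrite -ractDr; congr ract; congr pair; rewrite addr0.
- by move=> x r s; rewrite dorroh_incl_mul; exact: ractM.
Defined.

(** Since [a = (a.1, 0) + a.2 1] and [N] is unital, restriction to [R] loses no information. *)
Lemma ract_restr (N : urmodule (dorroh R)) (n : N) (a : dorroh R) :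
  ract n a = @ract _ (restr N) n a.1 + n *~ a.2.
Proof.
have Mz1 x : (1 : dorroh R) *~ x = (0, x).
  by rewrite [LHS]surjective_pairing !raddfMz /= mul0rz intz.
have aE : a = ((a.1, 0) : dorroh R) + 1 *~ a.2.
  by rewrite Mz1 [LHS]surjective_pairing; congr pair; rewrite ?addr0 ?add0r.
by rewrite {1}aE ractDr ractMzr ract1.
Qed.

Definition restr_tens_bal (N : urmodule (dorroh R)) : balanced N B (tens (restr N) (lreg R)).
Proof.
refine (@Balanced _ N B _ (@pure _ (restr N) (lreg R)) _ _ _).
- by move=> m m' n; rewrite -pureDl.
- by move=> m n n'; rewrite -pureDr.
(* The [R]-part of [a] crosses by balancedness over [R], the integer part by biadditivity. *)
- move=> n a r; rewrite ract_restr pureDl pureM /= pureDr; congr (_ + _).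
  by rewrite (@pureMzl _ (restr N)) (@pureMzr _ (restr N) (lreg R)).
Defined.

Definition restr_tens (N : urmodule (dorroh R)) :
  {additive tens N B -> tens (restr N) (lreg R)} := tlift (restr_tens_bal N).

Lemma restr_tens_pure (N : urmodule (dorroh R)) (n : N) (r : B) :
  restr_tens N (pure n r) = @pure _ (restr N) (lreg R) n r.
Proof. exact: tlift_pure. Qed.

(** Turns the counit law into a statement about the multiplication map over [R]. *)
Lemma mulr_restr_tens (N : urmodule (dorroh R)) (t : tens N B) :
  mulr_map (restr N) (restr_tens N t) =
  mulr_map N (tmap (rhom_id N) (dorroh_counit R) t).
Proof.
elim/tens_ind: t => [n r|x y hx hy]; last by rewrite !raddfD hx hy.
rewrite restr_tens_pure tmap_pure mulr_map_pure.
by rewrite [RHS](mulr_map_pure (M := N)).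
Qed.

Lemma coact_act (N : comodule C) (n : N) (r : R) :
  coact N (@ract _ (restr N) n r) = @pure _ N B n r.
Proof.
(* The [n] on the right becomes its counit expression; both sides are then additive in the tensor
   [coact N n], which may be taken to be pure. *)
rewrite [LHS](rfunZ (coact N) n (r, 0)) -{2}(coact1 n).
elim/tens_ind: (coact N n) => [m s|x y hx hy]; last first.
  by rewrite ractDl hx hy !raddfD pureDl.
rewrite [LHS](tens_ract_pure (C := B)) tmap_pure [in RHS](mulr_map_pure (M := N)) pureM.
by congr pure; rewrite /= !mulr0z !addr0.
Qed.

Lemma comod_firm (N : comodule C) : firm (restr N).
Proof.
exists (fun n => restr_tens N (coact N n)) => [t|n]; last first.
  by rewrite mulr_restr_tens; exact: coact1.
elim/tens_ind: t => [n r|x y hx hy]; last by rewrite !raddfD hx hy.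
by rewrite mulr_map_pure coact_act; exact: restr_tens_pure.
Qed.

Definition comod_firm_module (N : comodule C) : firm_module R :=
  FirmModule (@comod_firm N).

Definition restr_hom (M N : comodule C) (f : comod_hom M N) :
  rhom (comod_firm_module M) (comod_firm_module N) :=
  @RHom _ (restr M) (restr N) f (rfunB f) (fun x r => rfunZ f x (r, 0)).

Definition comod_to_firm : functor (comodule_cat C) (firm_cat R).
Proof.
refine (@Functor (comodule_cat C) (firm_cat R) comod_firm_module restr_hom _ _).
- by move=> M; exact: rhom_eq.
- by move=> M N P g f; exact: rhom_eq.
Defined.

(** Supplies the map required by [comodule_eq]: both coactions send [m r] to [m (x) r], and such
    products generate by firmness. *)
Lemma firm_comodule_restr_id_hom (N : comodule C) :
  exists f : comod_hom (firm_comodule hR (comod_firm_module N)) N,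
    rfun f = (fun x : N => x).
Proof.
have fZ (x : N) (a : dorroh R) : @ract _ (dorroh_ur (restr N)) x a = ract x a.
  exact: (esym (ract_restr x a)).
pose f : rhom (dorroh_ur (restr N)) N :=
  @RHom _ (dorroh_ur (restr N)) N id (fun _ _ => erefl) fZ.
have fP m : coact N (f m) = tmap f (lhom_id C) (firm_coact hR (comod_firm_module N) m).
  elim/(@firm_ind R (comod_firm_module N)): m => [m r|x y hx hy]; last first.
    by rewrite !rfunD hx hy raddfD.
  rewrite [firm_coact hR _ _]coact_fun_act tmap_pure.
  exact: coact_act.
by exists (@ComodHom _ C (firm_comodule hR (comod_firm_module N)) N f fP).
Qed.

End ComoduleToFirm.

(** * The two composites of functors are identities *)

Theorem theorem2p2 (R : rng) (hR : firm_rng R) :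
  cat_isomorphic (firm_cat R) (comodule_cat (dorroh_coring hR)).
Proof.
exists (firm_to_comod hR), (comod_to_firm hR); split.
- apply: (@functor_eq_id_faithful (firm_cat R)
    (functor_comp (comod_to_firm hR) (firm_to_comod hR)) (fun M : firm_module R => M : Type)
    (fun (M N : firm_module R) (f : rhom M N) => rfun f) _ _
    (fun (M : firm_module R) (x : M) => x)) => //.
    by move=> M N f g fg; apply: rhom_eq => x; rewrite fg.
  case=> [[S act D Dr ActM] P]; apply: firm_module_eq.
  (* The round trip changes the action only by the integer part of [(r, 0)], which is zero. *)
  by apply: funext => m; apply: funext => r; rewrite /= mulr0z addr0.
- apply: (@functor_eq_id_faithful (comodule_cat (dorroh_coring hR))
    (functor_comp (firm_to_comod hR) (comod_to_firm hR))
    (fun M : comodule (dorroh_coring hR) => M : Type)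
    (fun (M N : comodule (dorroh_coring hR)) (f : comod_hom M N) => rfun f) _ _
    (fun (M : comodule (dorroh_coring hR)) (x : M) => x)) => //.
    by move=> M N f g fg; apply: comod_hom_eq => x; rewrite fg.
  move=> N; have [f] := firm_comodule_restr_id_hom N.
  (* Unpacking [N] exposes the carrier [S] shared by both comodules. *)
  case: N f => [[[S act D Dr ActM] u] co coA co1] f fE.
  exact: (comodule_eq fE).
Qed.
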